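(* Let $\delta\in(0,\varepsilon)$ and $\beta\in(0,1]$. Suppose that $\theta^{(1)},\dots,\theta^{(N)}$ are independent and identically distributed realizations drawn from $\mathbb{P}$, that $\mathcal{D}^{(1)},\dots,\mathcal{D}^{(K)}$ is a (known) partition of $\mathcal{D}\supseteq\Theta$ in the sense described in the context, and that $$N\ \geq\ \frac{K\log 2+\log\frac1\beta}{2\delta^2}.$$ Then $$\mathbb{P}^N\left(\max_{\mathcal{J}\subseteq\{1,\dots,K\}}\left|\sum_{j\in\mathcal{J}}\left(\Pr(\theta\in\mathcal{D}^{(j)})-\hat p^{(j)}\right)\right|\leq\delta\right)\ \geq\ 1-\beta.$$
   Context: $\Theta\subset\mathbb{R}^{n_\theta}$ and $(\Theta,\mathfrak{B}(\Theta),\mathbb{P})$ is a probability space (Borel $\sigma$-algebra); $\theta$ is a random variable with law $\mathbb{P}$ and $\Pr$ is taken with respect to $\theta\sim\mathbb{P}$. $\mathbb{P}^N$ is the product measure, i.e. the law of the $N$ i.i.d. samples $(\theta^{(1)},\dots,\theta^{(N)})$. $\varepsilon\in[0,1)$ is a risk parameter; $N,K$ are positive integers. Partition: $\mathcal{D}\subset\mathbb{R}^{n_\theta}$ satisfies $\Theta\subseteq\mathcal{D}$, and $\mathcal{D}^{(1)},\dots,\mathcal{D}^{(K)}\subseteq\mathcal{D}$ are non-empty sets with $\bigcup_{j=1}^K\mathcal{D}^{(j)}=\mathcal{D}$ and $\Pr(\theta\in\mathcal{D}^{(i)}\cap\mathcal{D}^{(j)})=0$ for $i\neq j$. Empirical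 probabilities: $\mathcal{C}^{(j)}=\{i\in\{1,\dots,N\}:\theta^{(i)}\in\mathcal{D}^{(j)}\}$ and $\hat p^{(j)}=|\mathcal{C}^{(j)}|/N$ for $j=1,\dots,K$. *)

(* Defs.v *)
From HB Require Import structures.
From mathcomp Require Import all_boot all_order all_algebra.
From mathcomp Require Import all_classical all_reals all_analysis.

Set Implicit Arguments.
Unset Strict Implicit.
Unset Printing Implicit Defensive.

Import Order.TTheory GRing.Theory Num.Theory.
Import numFieldNormedType.Exports.

Local Open Scope classical_set_scope.
Local Open Scope ring_scope.

(* A as a topological space of its own. The proof that A is nonempty occurs in
   the type because measurable types are pointed; it costs no generality, since
   there is no probability measure on the empty set. *)
Definition subset_space (T : topologicalType) (A : set T) (A0 : A !=set0)
  : Type := set_type A.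

Section borel_space.
Context (T : topologicalType) (A : set T) (A0 : A !=set0).

HB.instance Definition _ := Topological.copy (subset_space A0) (set_type A).

HB.instance Definition _ := isPointed.Build (subset_space A0)
  (exist (fun x => x \in A) _ (mem_set (projT2 (cid A0)))).

Definition incl (x : subset_space A0) : T := set_val (x : set_type A).

(* The Borel sigma-algebra of A, generated by the relatively open subsets. *)
Definition borel_space : measurableType (sigma_display (@open (subset_space A0)))
  := g_sigma_algebraType (@open (subset_space A0)).

(* The event "theta \in D" for a random point theta of A. *)
Definition event (D : set T) : set borel_space := [set x | D (incl x)].

Lemma open_subset_spaceE (U : set (subset_space A0)) :
  open U <-> exists2 V : set T, open V & incl @^-1` V = U.
Proof. by []. Qed.

Lemma measurable_event (D : set T) : <<s @open T >> D -> measurable (event D).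
Proof.
suff sub : <<s @open T >> `<=` image_set_system setT incl
    (measurable : set (set borel_space)).
  by move=> /sub; rewrite /image_set_system /= setTI.
apply: smallest_sub; first exact/sigma_algebra_image/sigma_algebra_measurable.
move=> V oV; rewrite /image_set_system /= setTI.
by apply: sub_sigma_algebra; exists V.
Qed.

End borel_space.

Arguments event {T A} A0 D _.

Section pow_measure.
Context (d : measure_display) (T : measurableType d) (R : realType).

Definition tcons (n : nat) (x : T * n.-tuple T) : n.+1.-tuple T :=
  [the n.+1.-tuple T of x.1 :: x.2].

Lemma measurable_tcons n : measurable_fun setT (@tcons n).
Proof. exact: measurable_cons. Qed.

HB.instance Definition _ n :=
  isMeasurableFun.Build _ _ _ _ (@tcons n) (@measurable_tcons n).

(* The n-fold product of P on the product sigma-algebra of n.-tuple T;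
   pow_measure_rect is its characterization. *)
Fixpoint pow_measure (P : probability T R) (n : nat)
  : probability (n.-tuple T) R :=
  if n is m.+1 then distribution (P \x pow_measure P m)%E (@tcons m)
  else dirac [tuple].

Lemma pow_measure_rect (P : probability T R) n (A : 'I_n -> set T) :
  (forall i, measurable (A i)) ->
  pow_measure P n [set t | forall i, A i (tnth t i)] =
  (\prod_(i < n) P (A i))%E.
Proof.
elim: n A => [|n IH] A mA.
  by rewrite big_ord0 /= diracE mem_set// => -[].
have mB : measurable [set t : n.-tuple T | forall i, A (lift ord0 i) (tnth t i)].
  rewrite (_ : mkset _ = \big[setI/setT]_(i < n)
      ((fun t => tnth t i) @^-1` A (lift ord0 i))).
    by apply: bigsetI_measurable => i _; rewrite -[X in measurable X]setTI;
      exact: measurable_tnth.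
  rewrite -bigcap_seq; apply/seteqP; split=> t /= H i; first by move=> _; exact: H.
  by apply: (H i); rewrite /= mem_index_enum.
rewrite big_ord_recl -IH// -(product_measure1E P (pow_measure P n))//=.
rewrite /distribution /pushforward; congr ((P \x pow_measure P n)%E _).
apply/seteqP; split=> -[x t] /= H.
  by split=> [|i]; [have := H ord0|have := H (lift ord0 i); rewrite tnthS].
by move=> i; case: (unliftP ord0 i) => [j|] ->; rewrite ?tnthS; case: H.
Qed.

End pow_measure.

Section partition.
Context (R : realType) (n : nat) (Theta : set 'rV[R]_n) (Theta0 : Theta !=set0).

(* Pr(theta \in D), as a real number, for theta ~ P. *)
Definition Pr (P : probability (borel_space Theta0) R) (D : set 'rV[R]_n) : R :=
  fine (P (event Theta0 D)).

(* The cells may overlap, but only on a null set. The measurability clause is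
   what gives a meaning to Pr(theta \in Dj j); it only concerns the part of
   Dj j inside Theta, and holds for every Borel set Dj j (measurable_event). *)
Definition is_partition (P : probability (borel_space Theta0) R) (K : nat)
    (D : set 'rV[R]_n) (Dj : 'I_K -> set 'rV[R]_n) : Prop :=
  [/\ forall j, Dj j !=set0,
      forall j, Dj j `<=` D,
      \bigcup_j Dj j = D,
      forall j, measurable (event Theta0 (Dj j))
    & forall i j, i != j -> Pr P (Dj i `&` Dj j) = 0].

Definition cell_samples (N : nat) (s : N.-tuple (borel_space Theta0))
    (D : set 'rV[R]_n) : {set 'I_N} :=
  [set i : 'I_N | tnth s i \in event Theta0 D]%SET.

Definition emp_prob (N : nat) (s : N.-tuple (borel_space Theta0))
    (D : set 'rV[R]_n) : R :=
  #|cell_samples s D|%:R / N%:R.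

End partition.

(* Main.v *)
(* The Bretagnolle-Huber-Carol inequality. For a set J of cells, the deviation
   summed over J is almost surely the deviation of the empirical frequency of a
   single event, the union of the cells in J, so it obeys the one-sided Hoeffding
   bound exp (- 2 N delta^2). The deviation over the complement of J is the
   opposite one, hence a union bound over the 2^K subsets controls the absolute
   values as well, and the lower bound on N makes 2^K exp (- 2 N delta^2) at most
   beta. Hoeffding's bound is obtained without integrals: the probability that
   exactly the samples indexed by Z fall in a given event is an explicit product,
   and Chernoff's argument is a finite sum over Z. *)

Require Import Defs.
From mathcomp Require Import all_boot all_order all_algebra.
From mathcomp Require Import all_classical all_reals all_analysis.
From mathcomp Require Import ring lra.

Set Implicit Arguments.
Unset Strict Implicit.
Unset Printing Implicit Defensive.

Import Order.TTheory GRing.Theory Num.Theory.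
Import numFieldNormedType.Exports.

Local Open Scope classical_set_scope.
Local Open Scope ring_scope.

(** * The moment generating function of a Bernoulli variable *)

Section bernoulli_mgf.
Context (R : realType) (p : R).
Hypotheses (p_ge0 : 0 <= p) (p_le1 : p <= 1).

Let mgf (t : R) : R := 1 - p + p * expR t.

Let mgf_gt0 (t : R) : 0 < mgf t.
Proof.
rewrite /mgf; have e0 := expR_gt0 t.
have [->|p_neq0] := eqVneq p 0; first by rewrite subr0 mul0r addr0.
by rewrite ltr_wpDl ?subr_ge0// mulr_gt0// lt_def p_neq0.
Qed.

Let is_derive_mgf (t : R) : is_derive t 1 mgf (p * expR t).
Proof.
rewrite /mgf; apply: is_derive_eq; rewrite /GRing.scale/=; ring.
Qed.

(** The tilted mean q = [p * expR t / mgf t] equals p at 0 and has derivative q (1 - q), which is at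
    most 1/4 because 1/4 - q (1 - q) = (1/2 - q)^2. *)
Lemma tilted_mean_le t : 0 <= t -> p * expR t / mgf t <= p + t / 4.
Proof.
move=> t0.
pose f (s : R) := p + s / 4 - p * expR s / mgf s.
have df (s : R) : is_derive s 1 f ((2^-1 - p * expR s / mgf s) ^+ 2).
  have m0 := lt0r_neq0 (mgf_gt0 s).
  rewrite /f; have dV := is_deriveV m0 (is_derive_mgf s).
  apply: is_derive_eq; rewrite /GRing.scale/=.
  by rewrite /mgf in m0 *; field.
have : f 0 <= f t.
  apply: (@ger0_derive1_ndecry _ f 0) => //.
  - by move=> x _; rewrite derive1E (@derive_val _ _ _ _ _ _ _ (df x)) sqr_ge0.
  - apply: continuous_subspaceT => x; apply: differentiable_continuous.
    exact/derivable1_diffP.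
rewrite /f /mgf expR0; have -> : 1 - p + p * 1 = 1 by ring.
by lra.
Qed.

(* Hoeffding's lemma: the derivative of
   s |-> mgf s * expR (- (p * s + s ^+ 2 / 8)) has the sign of
   p * expR s / mgf s - (p + s / 4). *)
Lemma bernoulli_mgf_le t : 0 <= t ->
  1 - p + p * expR t <= expR (p * t + t ^+ 2 / 8).
Proof.
move=> t0.
pose g (s : R) := - (p * s + s ^+ 2 / 8).
pose f (s : R) := mgf s * expR (g s).
have dg (s : R) : is_derive s 1 g (- (p + s / 4)).
  by rewrite /g; apply: is_derive_eq; rewrite /GRing.scale/=; field.
have df (s : R) : is_derive s 1 f
    (mgf s * expR (g s) * (p * expR s / mgf s - (p + s / 4))).
  have m0 := lt0r_neq0 (mgf_gt0 s).
  have dE := is_derive1_comp (is_derive_expR (g s)) (dg s).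
  apply: is_derive_eq; rewrite /GRing.scale/=.
  by rewrite /mgf in m0 *; field.
have : f t <= f 0.
  apply: (@ler0_derive1_nincry _ f 0) => //.
  - move=> x /[!in_itv]/= /andP[x0 _].
    rewrite derive1E (@derive_val _ _ _ _ _ _ _ (df x)).
    rewrite mulr_ge0_le0 ?mulr_ge0 ?expR_ge0 ?(ltW (mgf_gt0 _))//.
    by rewrite subr_le0 tilted_mean_le ?ltW.
  - apply: continuous_subspaceT => x; apply: differentiable_continuous.
    exact/derivable1_diffP.
rewrite /f /g /mgf !expR0 mulr0 expr0n/= mul0r addr0 oppr0 expR0 !mulr1 subrK.
by rewrite expRN ler_pdivrMr ?expR_gt0// mul1r.
Qed.

End bernoulli_mgf.

Lemma measure_bigsetU_le (d : measure_display) (T : measurableType d)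
    (R : realType) (mu : {measure set T -> \bar R}) (I : Type) (r : seq I)
    (Q : pred I) (F : I -> set T) :
  (forall i, measurable (F i)) ->
  (mu (\big[setU/set0]_(i <- r | Q i) F i) <= \sum_(i <- r | Q i) mu (F i))%E.
Proof.
move=> mF; elim: r => [|i r IH]; first by rewrite !big_nil measure0.
rewrite !big_cons; case: ifP => // _.
apply: le_trans (leeD2l _ IH).
by apply: measureU2 => //; exact: bigsetU_measurable.
Qed.

(** * The set of samples falling in an event: its law, its lower tail, its additivity *)

Section hits.
Context (d : measure_display) (T : measurableType d) (R : realType).
Variables (P : probability T R) (N : nat).
Implicit Types (A : set T) (t : N.-tuple T) (Z : {set 'I_N}).

Definition hits t A : {set 'I_N} := [set i : 'I_N | tnth t i \in A]%SET.

(** Turns [hits t A = Z] into a box, whose probability is a product by [pow_measure_rect]. *)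
Let pattern A Z (i : 'I_N) := if i \in Z then A else ~` A.

Let hits_patternE A Z :
  [set t | hits t A = Z] = [set t | forall i, pattern A Z i (tnth t i)].
Proof.
apply/seteqP; split=> t /=.
  move=> <- i; rewrite /pattern inE; case: ifPn; first by rewrite inE.
  by rewrite notin_setE.
move=> H; apply/setP => i; rewrite inE; have := H i; rewrite /pattern.
by case: ifP => _ Ai; [rewrite mem_set|rewrite memNset].
Qed.

Lemma measurable_tnth_forall (A : 'I_N -> set T) :
  (forall i, measurable (A i)) -> measurable [set t | forall i, A i (tnth t i)].
Proof.
move=> mA.
rewrite (_ : mkset _ = \bigcap_(i in [set: 'I_N]) ((fun t => tnth t i) @^-1` A i)).
  apply: fin_bigcap_measurable => // i _; rewrite -[X in measurable X]setTI.
  exact: measurable_tnth.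
by apply/seteqP; split=> t H i => [_|]; exact: H.
Qed.

Lemma measurable_hits A Z : measurable A -> measurable [set t | hits t A = Z].
Proof.
move=> mA; rewrite hits_patternE; apply: measurable_tnth_forall => i.
by rewrite /pattern; case: ifP => // _; exact: measurableC.
Qed.

(** A family of hit sets takes finitely many values, so any condition [Q] on it, however
    complicated, is a finite union of measurable events. *)
Lemma measurable_hits_family (I : finType) (A : I -> set T)
    (Q : set {ffun I -> {set 'I_N}}) : (forall j, measurable (A j)) ->
  measurable [set t | Q [ffun j => hits t (A j)]].
Proof.
move=> mA.
rewrite (_ : mkset _ = \bigcup_(F in Q) \bigcap_(j in [set: I])
    [set t | hits t (A j) = F j]).
  apply: fin_bigcup_measurable => // F _.
  by apply: fin_bigcap_measurable => // j _; exact: measurable_hits.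
apply/seteqP; split=> t /=.
  by move=> Qt; exists [ffun j => hits t (A j)] => // j _; rewrite /= ffunE.
by move=> [F QF H]; congr (Q _): QF; apply/ffunP => j; rewrite ffunE H.
Qed.

Lemma measurable_card_hits (A : set T) (Q : set nat) : measurable A ->
  measurable [set t | Q #|hits t A|].
Proof.
move=> mA; have := @measurable_hits_family unit (fun=> A)
  [set F : {ffun unit -> {set 'I_N}} | Q #|F tt|] (fun=> mA).
by rewrite (_ : mkset _ = [set t | Q #|hits t A|])//; apply/seteqP; split=> t /=;
  rewrite ffunE.
Qed.

Lemma pow_measure_hits A Z : measurable A ->
  pow_measure P N [set t | hits t A = Z] =
  (\prod_(i < N) (if i \in Z then fine (P A) else 1 - fine (P A)))%:E.
Proof.
move=> mA; rewrite hits_patternE pow_measure_rect.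
  rewrite -prodEFin; apply: eq_bigr => i _; rewrite /pattern; case: ifP => _.
    by rewrite fineK ?fin_num_measure.
  by rewrite probability_setC// EFinB fineK ?fin_num_measure.
by move=> i; rewrite /pattern; case: ifP => // _; exact: measurableC.
Qed.

(* Chernoff's bound with the exponent [4 * delta], which is optimal for the
   Gaussian bound on the moment generating function. *)
Lemma hoeffding_card_hits A (delta : R) : measurable A -> 0 <= delta ->
  (pow_measure P N [set t | #|hits t A|%:R < N%:R * (fine (P A) - delta)]%R
   <= (expR (- (2 * delta ^+ 2) * N%:R))%:E)%E.
Proof.
move=> mA d0.
set p := fine (P A).
have p0 : 0 <= p by rewrite fine_ge0.
have p1 : p <= 1.
  by rewrite -lee_fin fineK ?fin_num_measure// probability_le1.
set lam := 4 * delta.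
have lam0 : 0 <= lam by rewrite mulr_ge0.
pose low Z := #|Z|%:R < N%:R * (p - delta).
rewrite (_ : mkset _ = \big[setU/set0]_(Z | low Z) [set t | hits t A = Z]); last first.
  apply/seteqP; split=> t /=.
    by move=> lt; rewrite (bigD1 (hits t A))//=; left.
  by rewrite -bigcup_seq_cond => -[Z /=] /andP[_ lowZ ->].
apply: le_trans (measure_bigsetU_le _ _ _ _) _.
  by move=> Z; exact: measurable_hits.
rewrite (eq_bigr _ (fun Z _ => pow_measure_hits Z mA)).
rewrite sumEFin lee_fin.
(* The probability of the hit set [Z], tilted by [expR (- lam * #|Z|%:R)]. *)
pose w Z := \prod_(i < N) (if i \in Z then p * expR (- lam) else 1 - p).
have w0 Z : 0 <= w Z.
  apply: prodr_ge0 => i _; case: ifP => _; last by rewrite subr_ge0.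
  by rewrite mulr_ge0 ?expR_ge0.
have wE Z : w Z =
    (\prod_(i < N) (if i \in Z then p else 1 - p)) * expR (- lam * #|Z|%:R).
  rewrite expRM_natr -prodr_const [X in _ * X]big_mkcond -big_split/=.
  by apply: eq_bigr => i _; case: ifP => _; rewrite ?mulr1.
(* Markov's inequality: the exponential factor is at least 1 when [low Z] holds, and the other terms
   are nonnegative. *)
apply: (@le_trans _ _ (\sum_Z expR (lam * (N%:R * (p - delta))) * w Z)).
  rewrite [leRHS](bigID low)/= -[leLHS]addr0 lerD//; last first.
    by apply: sumr_ge0 => Z _; rewrite mulr_ge0 ?expR_ge0.
  apply: ler_sum => Z lowZ; rewrite wE mulrCA -expRD -[leLHS]mulr1.
  apply: ler_wpM2l; first by
    apply: prodr_ge0 => i _; case: ifP => _; rewrite ?subr_ge0.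
  rewrite -[leLHS]expR0 ler_expR mulNr -mulrBr mulr_ge0// subr_ge0; exact: (ltW lowZ).
(* Summing the products over all [Z] gives the [N]-th power of [p * expR (- lam) + (1 - p)], so it
   is enough to compare the bases. *)
rewrite -mulr_sumr /w -(bigA_distr _ _ (fun=> p * expR (- lam)) (fun=> 1 - p)).
rewrite prodr_const card_ord mulrCA (mulrC N%:R) !expRM_natr -exprMn/=.
have q0 : 0 <= 1 - p by rewrite subr_ge0.
have q1 : 1 - p <= 1 by lra.
apply: lerXn2r; rewrite ?nnegrE ?expR_ge0//.
  by rewrite mulr_ge0 ?expR_ge0// addr_ge0// mulr_ge0 ?expR_ge0.
(* [bernoulli_mgf_le] is stated for nonnegative arguments: exchanging success and failure replaces
   [- lam] by [lam] and p by 1 - p. *)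
have -> : p * expR (- lam) + (1 - p) =
    expR (- lam) * (1 - (1 - p) + (1 - p) * expR lam).
  by rewrite mulrDr mulrCA -expRD addNr expR0; ring.
apply: le_trans (ler_wpM2l _ (ler_wpM2l _ (bernoulli_mgf_le q0 q1 lam0))) _;
  rewrite ?expR_ge0// -!expRD ler_expR.
(* The exponents add up to - lam delta + lam^2 / 8 = - 2 delta^2. *)
by rewrite /lam; lra.
Qed.

(** Union bound over the index [i] of the sample in [A]: each box [B i] has one factor [P A = 0]. *)
Lemma pow_measure_ex_tnth A : measurable A -> P A = 0%E ->
  pow_measure P N [set t | exists i, A (tnth t i)] = 0%E.
Proof.
move=> mA A0; apply/eqP; rewrite eq_le measure_ge0 andbT.
pose B (i j : 'I_N) := if j == i then A else [set: T].
have mB i j : measurable (B i j) by rewrite /B; case: ifP.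
rewrite (_ : mkset _ = \big[setU/set0]_(i < N)
    [set t : N.-tuple T | forall j, B i j (tnth t j)]).
  apply: le_trans (measure_bigsetU_le _ _ _ _) _.
    by move=> i; exact: measurable_tnth_forall.
  rewrite big1// => i _; apply: etrans (pow_measure_rect P (mB i)) _.
  by rewrite (bigD1 i)//= /B eqxx A0 mul0e.
rewrite -bigcup_seq; apply/seteqP; split=> t /= [i].
  move=> Ai; exists i; first by rewrite /= mem_index_enum.
  by move=> j; rewrite /B; case: eqP => [->|].
by move=> _ /(_ i); rewrite /B eqxx; exists i.
Qed.

(** Double counting: disjointness lets each sample contribute to at most one [E j]. *)
Lemma sum_card_hits (I : finType) (E : I -> set T) (J : {set I}) t :
  trivIset setT E ->
  (\sum_(j in J) #|hits t (E j)| = #|hits t (\bigcup_(j in [set` J]) E j)|)%N.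
Proof.
move=> tE.
have cardE A : #|hits t A| = (\sum_(i < N) (tnth t i \in A))%N.
  by rewrite -sum1_card big_mkcond; apply: eq_bigr => i _; rewrite inE; case: ifP.
under eq_bigr do rewrite cardE.
rewrite cardE exchange_big; apply: eq_bigr => i _ /=.
have [|/asboolPn nE] := boolP (`[< (\bigcup_(j in [set` J]) E j) (tnth t i) >]).
  move=> /asboolP U; rewrite mem_set//; case: U => j jJ Ej.
  rewrite (bigD1 j)//= mem_set// big1// => k /andP[_ kj].
  rewrite memNset// => Ek; move/eqP: kj; apply.
  by apply: tE => //; exists (tnth t i).
rewrite memNset// big1// => j jJ; rewrite memNset// => Ej.
by apply: nE; exists j.
Qed.

Lemma sum_fine_measure (I : finType) (E : I -> set T) (J : {set I}) :
  (forall j, measurable (E j)) -> trivIset setT E ->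
  \sum_(j in J) fine (P (E j)) = fine (P (\bigcup_(j in [set` J]) E j)).
Proof.
move=> mE tE; rewrite measure_fin_bigcup//; last exact: sub_trivIset tE.
rewrite sum_fine; last by move=> j _; exact: fin_num_measure.
by congr fine; apply: bigfs; rewrite ?index_enum_uniq// => j _; rewrite mem_index_enum.
Qed.

(** * Deviations over the cells of a partition up to null sets *)

Section partition_deviation.
Variables (I : finType) (A : I -> set T).
Hypotheses (mA : forall j, measurable (A j)) (coverA : \bigcup_j A j = setT).
Hypothesis overlapA : forall i j, i != j -> P (A i `&` A j) = 0%E.

Let overlap := \big[setU/set0]_(ij : I * I | ij.1 != ij.2) (A ij.1 `&` A ij.2).

Let m_overlap : measurable overlap.
Proof. by apply: bigsetU_measurable => ij _; exact: measurableI. Qed.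

Let overlap0 : P overlap = 0%E.
Proof.
apply/eqP; rewrite eq_le measure_ge0 andbT.
apply: le_trans (measure_bigsetU_le _ _ _ _) _.
  by move=> ij; exact: measurableI.
by rewrite big1// => ij; exact: overlapA.
Qed.

(** Removing the null set [overlap] makes the cells disjoint and keeps their probabilities. *)
Let E j := A j `\` overlap.

Let mE j : measurable (E j). Proof. exact: measurableD. Qed.

Let overlapP x i j : i != j -> A i x -> A j x -> overlap x.
Proof.
move=> ij Ai Aj; rewrite /overlap -bigcup_seq_cond.
by exists (i, j) => //=; rewrite mem_index_enum.
Qed.

Let trivE : trivIset setT E.
Proof.
move=> i j _ _ [x [[Ai nx] [Aj _]]]; apply/eqP/negPn/negP => ij.
by apply: nx; exact: overlapP ij Ai Aj.
Qed.

Let PE j : P (E j) = P (A j).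
Proof.
rewrite [RHS](measureDI P (mA j) m_overlap).
rewrite (@subset_measure0 _ _ _ P (A j `&` overlap) overlap) ?adde0//.
exact: measurableI.
Qed.

Let union (J : {set I}) := \bigcup_(j in [set` J]) E j.

Let cardE (t : N.-tuple T) j : ~ (exists i, overlap (tnth t i)) ->
  hits t (A j) = hits t (E j).
Proof.
move=> nt; apply/setP => i; rewrite !inE; apply/idP/idP; rewrite !inE.
  by move=> Aj; split=> // ov; apply: nt; exists i.
by case.
Qed.

Let deviation (t : N.-tuple T) (J : {set I}) :=
  \sum_(j in J) (fine (P (A j)) - #|hits t (A j)|%:R / N%:R).

Let deviationE t J : ~ (exists i, overlap (tnth t i)) ->
  deviation t J = fine (P (union J)) - #|hits t (union J)|%:R / N%:R.
Proof.
move=> nt; rewrite /union -sum_fine_measure// -sum_card_hits// natr_sum mulr_suml.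
by rewrite -sumrB; apply: eq_bigr => j _; rewrite PE cardE.
Qed.

Let union_setT : union [set: I]%SET = ~` overlap.
Proof.
apply/seteqP; split=> x /=; first by move=> [j _ []].
move=> nx; have [j _ Aj] : (\bigcup_j A j) x by rewrite coverA.
by exists j => //=; rewrite finset.in_setT.
Qed.

(** Off [overlap] the cells [E j] cover everything, so their union has both probability and
    empirical frequency 1. *)
Let deviation_setT t : (0 < N)%N -> ~ (exists i, overlap (tnth t i)) ->
  deviation t [set: I]%SET = 0.
Proof.
move=> N0 nt; rewrite deviationE// union_setT probability_setC// overlap0 sube0/=.
rewrite (_ : hits _ _ = [set: 'I_N]%SET) ?cardsT ?card_ord ?divff ?subrr//.
  by rewrite pnatr_eq0 -lt0n.
apply/setP => i; rewrite !inE mem_set// => ov; by apply: nt; exists i.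
Qed.

(* As the deviations over all cells add up to 0 almost surely, the deviation of
   the complement of J is the opposite of that of J, so that one-sided bounds
   suffice: this saves a factor 2 in the union bound. *)
Lemma max_deviation_le (delta : R) : (0 < N)%N -> 0 <= delta ->
  (1 - (2 ^+ #|I| * expR (- (2 * delta ^+ 2) * N%:R))%:E <=
   pow_measure P N [set t |
     \big[Num.max/0]_(J : {set I})
       `|\sum_(j in J) (fine (P (A j)) - #|hits t (A j)|%:R / N%:R)|
     <= delta]%R)%E.
Proof.
move=> N0 d0; set good := mkset _.
have mgood : measurable good.
  have := @measurable_hits_family I A [set F : {ffun _ -> {set 'I_N}} |
    \big[Num.max/0]_(J : {set I})
      `|\sum_(j in J) (fine (P (A j)) - #|F j|%:R / N%:R)| <= delta] mA.
  congr (measurable _); apply/funext => t; rewrite /good/mkset.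
  congr (is_true (_ <= _)); apply: eq_bigr => J _; congr `|_|.
  by apply: eq_bigr => j _; rewrite ffunE.
have munion J : measurable (union J) by exact: fin_bigcup_measurable.
pose low J := [set t : N.-tuple T |
  #|hits t (union J)|%:R < N%:R * (fine (P (union J)) - delta)].
have mlow J : measurable (low J).
  exact: (measurable_card_hits [set k | k%:R < N%:R * _]).
(* Outside [bad], no sample is in [overlap] and no union of cells is hit too rarely. *)
pose bad := [set t : N.-tuple T | exists i, overlap (tnth t i)] `|`
  \big[setU/set0]_(J : {set I}) low J.
have mex : measurable [set t : N.-tuple T | exists i, overlap (tnth t i)].
  have := @measurable_hits_family unit (fun=> overlap)
    [set F : {ffun _ -> {set 'I_N}} | exists i, i \in F tt] (fun=> m_overlap).
  congr (measurable _); apply/seteqP; split=> t /= [i].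
    by rewrite ffunE !inE => ov; exists i.
  by move=> ov; exists i; rewrite ffunE !inE.
have mlows : measurable (\big[setU/set0]_(J : {set I}) low J).
  exact: bigsetU_measurable.
have mbad : measurable bad by exact: measurableU.
have nbad : ~` good `<=` bad.
  move=> t; apply: contra_notP => /not_orP[nt nlow].
  have dev_le J : deviation t J <= delta.
    rewrite deviationE// lerBlDr -lerBlDl ler_pdivlMr ?ltr0n// mulrC leNgt.
    apply/negP => lt; apply: nlow; rewrite -bigcup_seq.
    by exists J => //=; rewrite mem_index_enum.
  have devC J : deviation t (~: J)%SET = - deviation t J.
    apply/eqP; rewrite -addr_eq0 addrC -(deviation_setT N0 nt).
    apply/eqP; rewrite /deviation [RHS](bigID (mem J))/=; congr (_ + _);
      by apply: eq_bigl => j; rewrite !inE.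
  (* The default value 0 of the maximum is within the bound as [delta] is nonnegative; the lower
     bound on the deviation of [J] is the upper bound for its complement. *)
  apply: bigmax_le => // J _; rewrite ler_norml dev_le andbT.
  by rewrite lerNl -devC.
have Pbad : (pow_measure P N bad <=
    (2 ^+ #|I| * expR (- (2 * delta ^+ 2) * N%:R))%:E)%E.
  apply: le_trans (measureU2 _ _ _) _ => //.
  rewrite -[leRHS]add0e; apply: leeD.
    by rewrite le_eqVlt; apply/predU1l/(pow_measure_ex_tnth m_overlap overlap0).
  (* One Hoeffding bound for each of the [2 ^+ #|I|] subsets. *)
  apply: le_trans (measure_bigsetU_le _ _ _ _) _ => //.
  apply: le_trans (lee_sum _ (fun J _ => hoeffding_card_hits (munion J) d0)) _.
  by rewrite sumEFin lee_fin sumr_const -[X in _ *+ X]cardsT -powersetT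
    card_powerset cardsT -[leLHS]mulr_natl natrX.
rewrite leeBlDr// -leeBlDl; last exact: fin_num_measure.
apply: le_trans Pbad.
rewrite -(probability_setC (pow_measure P N) mgood).
by apply: le_measure nbad; apply: mem_set => //; exact: measurableC.
Qed.

End partition_deviation.
End hits.

(** * The sample size that makes the failure probability at most [beta] *)

Theorem lemma1 (R : realType) (n N K : nat)
  (Theta : set 'rV[R]_n) (Theta0 : Theta !=set0)
  (P : probability (borel_space Theta0) R)
  (D : set 'rV[R]_n) (Dj : 'I_K -> set 'rV[R]_n)
  (eps delta beta : R)
  (N_gt0 : (0 < N)%N) (K_gt0 : (0 < K)%N)
  (eps_ge0 : 0 <= eps) (eps_lt1 : eps < 1)
  (delta_gt0 : 0 < delta) (delta_lt : delta < eps)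
  (beta_gt0 : 0 < beta) (beta_le1 : beta <= 1)
  (ThetaD : Theta `<=` D)
  (partD : is_partition P D Dj)
  (N_ge : (K%:R * ln 2 + ln (1 / beta)) / (2 * delta ^+ 2) <= N%:R) :
  ((1 - beta)%:E <=
   pow_measure P N
     [set s | \big[Num.max/0]_(J : {set 'I_K})
                `|\sum_(j in J) (Pr P (Dj j) - emp_prob s (Dj j))| <= delta]%R)%E.
Proof.
have [_ _ coverD mD overlapD] := partD.
have cover : \bigcup_j event Theta0 (Dj j) = setT.
  apply/seteqP; split=> // x _.
  have : D (Defs.incl x) := ThetaD _ (set_mem (svalP x)).
  by rewrite -coverD => -[j _ ?]; exists j.
have overlap i j : i != j -> P (event Theta0 (Dj i) `&` event Theta0 (Dj j)) = 0%E.
  (* [fine] also sends infinite values to 0, hence the finiteness check. *)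
  move=> /overlapD Pr0; rewrite -[LHS]fineK; first by congr EFin.
  by apply: fin_num_measure; exact: measurableI.
(* [Pr] and [emp_prob] unfold to the measures and hit counts of the events [event Theta0 (Dj j)]. *)
apply: le_trans (max_deviation_le mD cover overlap N_gt0 (ltW delta_gt0)).
rewrite -EFinB lee_fin lerD2l lerN2 card_ord.
have -> : 2 ^+ K = expR (K%:R * ln 2) :> R.
  by rewrite expRM_natl lnK// posrE.
(* After taking logarithms, the claim is K ln 2 - 2 N delta^2 <= ln beta, which is [N_ge]
   rearranged. *)
move: N_ge; rewrite ler_pdivrMr ?mulr_gt0 ?exprn_gt0// => N_ge.
rewrite -expRD -[leRHS]lnK ?posrE// ler_expR.
by move: N_ge; rewrite div1r lnV ?posrE//; lra.
Qed.
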